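(* Assume that $(\mathbb{X},\mathcal{X})$ is a Borel space. Let $h:\mathbf{N}^*\times\mathbb{R}_+\times\mathbb{X}\to\mathbb{R}$ be measurable. Then $h$ is $\mathcal{P}$-measurable if and only if $$h(\mu,s,x)=h(\mu_{s-},s,x),\qquad(\mu,s,x)\in\mathbf{N}^*\times\mathbb{R}_+\times\mathbb{X}.$$
   Context: A Borel space is a measurable space that is Borel isomorphic to a Borel subset of $[0,1]$. Let $\mathbb{Y}:=\mathbb{R}_+\times\mathbb{X}$, $\mathbb{R}_+=[0,\infty)$, with product $\sigma$-field $\mathcal{Y}$. $\mathbf{N}$ is the space of $\sigma$-finite measures on $\mathbb{Y}$ with values in $\{0,1,2,\dots\}\cup\{\infty\}$, equipped with the smallest $\sigma$-field making all $\mu\mapsto\mu(B)$, $B\in\mathcal{Y}$, measurable. For $\mu\in\mathbf{N}$ and $s\ge0$, $\mu_{s-}$ is the restriction of $\mu$ to $[0,s)\times\mathbb{X}$. Let $C_1,C_2,\dots$ be a sequence of disjoint measurable subsets of $\mathbb{Y}$ with union $\mathbb{Y}$, and let $\mathbf{N}^*$ be the measurable set of all $\mu\in\mathbf{N}$ with $\mu(\{0\}\times\mathbb{X})=0$ and $\mu(C_n)<\infty$ for all $n\in\mathbb{N}$ (with the trace $\sigma$-field). For $t\ge 0$, $\mathcal{N}_t$ is the smallest $\sigma$-field of subsets of $\mathbf{N}^*$ making the maps $\mu\mapsto\mu(B\cap([0,t]\times\mathbb{X}))$ measurable for all $B\in\mathcal{Y}$. The predictable $\sigma$-field $\mathcal{P}$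 on $\mathbf{N}^*\times\mathbb{R}_+\times\mathbb{X}$ is the smallest $\sigma$-field containing the sets $$A\times(s,t]\times B,\quad s<t,\ A\in\mathcal{N}_s,\ B\in\mathcal{X}.$$
   Formalization: The predictable σ-field is enlarged by the sets N*×[0,t]×B, t≥0 (generators with s<0 and trivial N_s); with s≥0 only, P-measurable h would be constant on N*×{0}×X and the ''if'' part fails, e.g. for h=x·1{s=0}, X=[0,1]. *)

(* Defs.v *)
From HB Require Import structures.
From mathcomp Require Import all_boot all_order all_algebra.
From mathcomp Require Import all_classical all_reals all_analysis.
From mathcomp Require Import measurable_realfun.
Set Implicit Arguments.
Unset Strict Implicit.
Unset Printing Implicit Defensive.
Import Order.TTheory GRing.Theory Num.Theory.
Local Open Scope classical_set_scope.
Local Open Scope ring_scope.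

(* As S is measurable, measurability of g on S is measurability for the trace
   sigma-field on S. *)
Definition borel_space (R : realType) d (X : measurableType d) : Prop :=
  exists (S : set R) (f : X -> R) (g : R -> X),
    [/\ measurable S, S `<=` `[0, 1]%classic, forall x, S (f x),
        cancel f g & {in S, cancel g f}] /\
    measurable_fun [set: X] f /\ measurable_fun S g.

Definition Rplus (R : realType) : Type := {x : R | 0 <= x}.

Section Rplus.
Variable R : realType.
HB.instance Definition _ := Choice.on (Rplus R).
HB.instance Definition _ :=
  isPointed.Build (Rplus R) (exist (fun x : R => 0 <= x) 0 (lexx 0)).
Definition Rplus_val : Rplus R -> R := val.
(* the trace of the Borel sigma-field *)
HB.instance Definition _ :=
  Measurable.copy (Rplus R) (g_sigma_algebra_preimageType Rplus_val).
End Rplus.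

(* The measures of mathcomp-analysis are defined on all subsets, but the
   measure axioms and all conditions below only concern measurable ones. *)
Definition Nspace_set (R : realType) d (Y : measurableType d) :
    set {measure set Y -> \bar R} :=
  [set mu | sigma_finite [set: Y] mu /\
    forall B, measurable B -> mu B = +oo%E \/ exists n : nat, mu B = n%:R%:E].

Definition Nspace (R : realType) d (Y : measurableType d) : Type :=
  @Nspace_set R d Y.

Section Nspace.
Context (R : realType) d (Y : measurableType d).
Local Notation N := (Nspace R Y).

Definition N_ev (mu : N) (B : set Y) : \bar R := sval mu B.

Lemma Nspace0_subproof :
  (@mzero d Y R : {measure set Y -> \bar R}) \in @Nspace_set R d Y.
Proof.
rewrite inE; split; first exact: sigma_finite_mzero.
by move=> B _; right; exists 0%N.
Qed.

Definition Nspace0 : N :=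
  exist (fun mu => mu \in @Nspace_set R d Y) _ Nspace0_subproof.

HB.instance Definition _ := gen_eqMixin N.
HB.instance Definition _ := gen_choiceMixin N.
HB.instance Definition _ := isPointed.Build N Nspace0.

Definition N_ev_preimages : set (set N) :=
  \bigcup_(B in (measurable : set (set Y)))
    preimage_set_system [set: N] (N_ev ^~ B) measurable.

HB.instance Definition _ :=
  Measurable.copy N (g_sigma_algebraType N_ev_preimages).
End Nspace.

Section Nstar.
Context (R : realType) d (X : measurableType d).
Local Notation Y := (Rplus R * X)%type.

(* strip I is (I `&` R_+) x X *)
Definition strip (I : set R) : set Y := [set y | I (val y.1)].

Lemma measurable_strip (I : set R) : measurable I -> measurable (strip I).
Proof.
move=> mI; have -> : strip I = (val @^-1` I : set (Rplus R)) `*` [set: X].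
  by apply/seteqP; split => [y|y []].
apply: measurableX => //.
by exists I => //; rewrite setTI.
Qed.

Variable C : nat -> set Y.

Definition Nstar_set : set (Nspace R Y) :=
  [set mu | N_ev mu (strip [set 0]) = 0%E /\
            forall n, (N_ev mu (C n) < +oo)%E].

Definition Nstar : Type := Nstar_set.

Definition Nstar_ev (mu : Nstar) (B : set Y) : \bar R := N_ev (sval mu) B.

Lemma Nstar0_subproof : Nspace0 R Y \in Nstar_set.
Proof. by rewrite inE; split => // n; rewrite ltry. Qed.

Definition Nstar0 : Nstar := exist (fun mu => mu \in Nstar_set) _ Nstar0_subproof.

HB.instance Definition _ := gen_eqMixin Nstar.
HB.instance Definition _ := gen_choiceMixin Nstar.
HB.instance Definition _ := isPointed.Build Nstar Nstar0.
Definition Nstar_val : Nstar -> Nspace R Y := sval.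
HB.instance Definition _ :=
  Measurable.copy Nstar (g_sigma_algebra_preimageType Nstar_val).

Section restriction.
Variables (s : R) (mu : Nstar).

Definition before_measure : {measure set Y -> \bar R} :=
  mrestr (sval (sval mu)) (measurable_strip (measurable_itv `[0, s[)).

Lemma before_N_subproof : before_measure \in @Nspace_set R _ Y.
Proof.
have mS := measurable_strip (measurable_itv `[0, s[).
have /set_mem[/= [F FT mF] muN] := proj2_sig (sval mu).
rewrite inE; split => [|B mB] /=; last by apply: muN; exact: measurableI.
exists F => // n; have [mFn Fn] := mF n; split => //.
apply: le_lt_trans Fn; apply: le_measure; rewrite ?inE //.
exact: measurableI.
Qed.

Definition before_N : Nspace R Y :=
  exist (fun mu => mu \in @Nspace_set R _ Y) _ before_N_subproof.
End restriction.

Hypothesis mC : forall n, measurable (C n).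

Lemma before_Nstar_subproof s mu : before_N s mu \in Nstar_set.
Proof.
have mS := measurable_strip (measurable_itv `[0, s[).
have m0 : measurable (strip [set 0]) by exact: measurable_strip.
have /set_mem[mu0 muC] := proj2_sig mu.
rewrite inE; split => [|n].
- apply/eqP; rewrite eq_le measure_ge0 andbT -mu0.
  by apply: le_measure; rewrite ?inE //; exact: measurableI.
- apply: le_lt_trans (muC n).
  by apply: le_measure; rewrite ?inE //; exact: measurableI.
Qed.

(* the restriction mu_{s-} of mu to [0, s) x X *)
Definition before (mu : Nstar) (s : Rplus R) : Nstar :=
  exist (fun mu => mu \in Nstar_set) _ (before_Nstar_subproof (val s) mu).

(* The sigma-field N_t.  The formula makes sense for all real t; as [0, t] is
   empty for t < 0, it then yields the trivial sigma-field. *)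
Definition Nfiltration (t : R) : set (set Nstar) :=
  <<s \bigcup_(B in (measurable : set (set Y)))
        preimage_set_system [set: Nstar]
          (fun mu => Nstar_ev mu (B `&` strip `[0, t]%classic)) measurable >>.

(* The sets A x (s, t] x B; as s ranges over all reals, the time section
   (s, t] `&` R_+ may contain 0 (for s < 0 and A in the trivial N_s).
   With only s >= 0 no generator would meet {time = 0}, so that a predictable
   function would have to be constant there. *)
Definition predictable_rectangles : set (set (Nstar * Rplus R * X)) :=
  [set D | exists (s t : R) (A : set Nstar) (B : set X),
     [/\ s < t, Nfiltration s A, measurable B &
         D = A `*` [set r | val r \in `]s, t] ] `*` B] ].

Definition predictable_type : Type := g_sigma_algebraType predictable_rectangles.
HB.instance Definition _ := Measurable.on predictable_type.

Definition predictable_fun (h : Nstar * Rplus R * X -> R) : Prop :=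
  measurable_fun [set: predictable_type] (h : predictable_type -> R).
End Nstar.

(* Main.v *)
(* For fixed mu and s, the family of predictable sets that do not separate
   (mu, s, x) from (mu_{s-}, s, x) is a sigma-field; it contains the generators
   A x (r, t] x B, because a set of N_r depends on mu only through [0, r] x X,
   where mu and mu_{s-} agree if r < s.  Conversely, (mu, s, x) |->
   (mu_{s-}, s, x) is measurable from the predictable to the product
   sigma-field: by continuity from below, mu_{s-}(B) > a iff
   mu(B `&` [0, q] x X) > a for some rational q < s, and this is a countable
   union of predictable rectangles. *)
Require Import Defs.
From mathcomp Require Import all_boot all_order all_algebra.
From mathcomp Require Import all_classical all_reals all_analysis.
From mathcomp Require Import measurable_realfun.
Import Order.TTheory GRing.Theory Num.Theory.
Local Open Scope classical_set_scope.
Local Open Scope ring_scope.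

Lemma sigma_algebra_iff T (p q : T) :
  sigma_algebra setT [set A : set T | A p <-> A q].
Proof.
split => [|A /= Apq|F /= Fpq]; first by [].
- by split => -[_ nA]; split => // /Apq.
- by split => -[n _ Fn]; exists n => //; apply/Fpq.
Qed.

Lemma generated_iff T (G : set (set T)) (p q : T) :
  (forall A, G A -> A p <-> A q) -> forall A, <<s G >> A -> A p <-> A q.
Proof.
by move=> Gpq; apply: smallest_sub => //; exact: sigma_algebra_iff.
Qed.

(** The sigma-field of [Nstar C] is pulled back along [Nstar_val] from one generated by the
    evaluations, so preimages of the generators suffice. *)
Lemma measurable_fun_Nstar (R : realType) d (X : measurableType d)
    (C : nat -> set (Rplus R * X)) d' (T : measurableType d')
    (f : T -> Nstar C) :
  (forall B, measurable B ->
    measurable_fun [set: T] (fun t => Nstar_ev (f t) B)) ->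
  measurable_fun [set: T] f.
Proof.
move=> mf.
suff mNf : measurable_fun [set: T] (@Nstar_val R d X C \o f).
  by move=> _ _ [A mA <-]; rewrite setTI; exact: mNf.
apply: (measurability (@N_ev_preimages R _ (Rplus R * X)%type)) => //.
move=> _ [_ [B mB [E mE <-]] <-]; rewrite setTI.
exact: mf.
Qed.

Section before.
Context (R : realType) (d : measure_display) (X : measurableType d).
Context (C : nat -> set (Rplus R * X)) (mC : forall n, measurable (C n)).

Lemma before_ev_gt (a : \bar R) (mu : Nstar C) (s : Rplus R)
    (B : set (Rplus R * X)) : measurable B ->
  (a < Nstar_ev (before mC mu s) B)%E <->
  exists2 q : rat, ratr q < val s &
    (a < Nstar_ev mu (B `&` strip `[0%R, ratr q]%classic))%E.
Proof.
move=> mB; set m : {measure set _ -> \bar R} := sval (sval mu).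
have mBs (I : set R) : measurable I -> measurable (B `&` @strip R d X I).
  by move=> mI; apply: measurableI => //; exact: measurable_strip.
have le_m (I J : set R) : measurable I -> measurable J -> I `<=` J ->
    (m (B `&` strip I) <= m (B `&` strip J))%E.
  move=> mI mJ IJ; apply: le_measure; rewrite ?inE; [exact: mBs..|].
  by apply: setIS => y; exact: IJ.
split=> [|[q qs amu]]; last first.
  apply: (lt_le_trans amu); apply: le_m => // x /=.
  by rewrite !in_itv/= => /andP[-> /le_lt_trans]; apply.
(* The half-open [[0, s[] is the increasing union of the closed intervals [[0, s - 1/(n+1)]]. *)
have -> : Nstar_ev (before mC mu s) B =
    m (\bigcup_n (B `&` strip `[0, val s - n.+1%:R^-1]%classic)).
  rewrite -setI_bigcupr /Nstar_ev /N_ev /= /mrestr.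
  by congr (m (_ `&` _)); rewrite itv_bnd_open_bigcup.
set F := fun n : nat => B `&` @strip R d X `[0, val s - n.+1%:R^-1]%classic.
have ndF : nondecreasing_seq F.
  move=> i j ij; apply/subsetPset; apply: setIS => y; rewrite /strip /= !in_itv/=.
  move=> /andP[-> /le_trans]; apply; rewrite lerD2l lerN2 lef_pV2 ?posrE//.
  by rewrite ler_nat ltnS.
have mF n : measurable (F n) by exact: mBs.
have muF := nondecreasing_cvg_mu (mu := m) mF (bigcupT_measurable _ mF) ndF.
(* If no rational works, every [F n] has measure at most [a], hence so does the limit, against
   [aF]. *)
move=> aF; apply: contrapT => nq.
have : (limn (m \o F) <= a)%E.
  apply: lime_le; first by apply/cvg_ex; eexists; exact: muF.
  near=> n; rewrite leNgt; apply/negP => amF; apply: nq.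
  (* This [q] can be negative: for [s = 0] all the strips are empty, and such a [q] is the witness
     when [a < 0]. *)
  have /rat_in_itvoo[q] : val s - n.+1%:R^-1 < val s by rewrite ltrBlDr ltrDl.
  rewrite in_itv/= => /andP[nq qs]; exists q => //.
  apply: (lt_le_trans amF); apply: le_m => // x /=.
  by rewrite !in_itv/= => /andP[-> /le_trans]; apply; exact: ltW.
by rewrite leNgt (cvg_lim _ muF)// aF.
Unshelve. all: end_near. Qed.

Lemma Nfiltration_before (t : R) (A : set (Nstar C)) (mu : Nstar C)
    (s : Rplus R) :
  t < val s -> Nfiltration t A -> A (before mC mu s) <-> A mu.
Proof.
move=> ts; apply: generated_iff => _ [B mB [E mE <-]].
rewrite !setTI /preimage /=.
suff -> : Nstar_ev (before mC mu s) (B `&` strip `[0, t]%classic) =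
    Nstar_ev mu (B `&` strip `[0, t]%classic) by [].
rewrite /Nstar_ev /N_ev /= /mrestr -setIA; congr (sval (sval mu) (_ `&` _)).
apply: setIidl => y; rewrite /strip /= !in_itv/= => /andP[-> yt].
exact: le_lt_trans ts.
Qed.

Lemma predictable_before (D : set (Nstar C * Rplus R * X)) (mu : Nstar C)
    (s : Rplus R) (x : X) :
  <<s @predictable_rectangles R d X C >> D ->
  D (before mC mu s, s, x) <-> D (mu, s, x).
Proof.
apply: generated_iff => _ [r [t [A [B [_ FA _ ->]]]]].
(* The time interval is open on the left, so it yields the strict [r < s] under which [A] cannot
   tell the two measures apart. *)
split=> -[[/= Amu srt] Bx]; split => //=; split => //; move: (srt);
  rewrite in_itv/= => /andP[rs _]; exact/(Nfiltration_before _ _ _ _ rs).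
Qed.

(** Countably many bounded windows []t, t + n + 1]] exhaust the times after [t]. The preimages
    computed below all have this unbounded form. *)
Lemma measurable_predictable_after (t : R) (A : set (Nstar C)) (B : set X) :
  Nfiltration t A -> measurable B ->
  measurable (A `*` [set r : Rplus R | t < val r] `*` B : set (predictable_type C)).
Proof.
move=> FA mB.
have -> : A `*` [set r : Rplus R | t < val r] `*` B =
    \bigcup_n (A `*` [set r : Rplus R | val r \in `]t, t + n.+1%:R]] `*` B).
  apply/seteqP; split=> [[[mu r] x] [[/= Amu tr] Bx]|[[mu r] x] [n _]].
    exists (Num.truncn (val r - t)) => //; split => //; split => //=.
    by rewrite in_itv/= tr/= -lerBlDl ltW// truncnS_gt.
  by move=> [[/= Amu]]; rewrite in_itv/= => /andP[tr _] Bx.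
apply: bigcupT_measurable => n; apply: sub_sigma_algebra.
by exists t, (t + n.+1%:R), A, B; split => //; rewrite ltrDl.
Qed.

Lemma Nfiltration_setT (t : R) : Nfiltration t [set: Nstar C].
Proof.
by rewrite -setC0 -setTD; apply: sigma_algebraCD; exact: sigma_algebra0.
Qed.

Lemma measurable_predictable_time :
  measurable_fun [set: predictable_type C]
    (fun p : predictable_type C => p.1.2 : Rplus R).
Proof.
suff mt : measurable_fun [set: predictable_type C]
    (fun p : predictable_type C => val p.1.2 : R).
  by move=> _ _ [I mI <-]; rewrite setTI; exact: mt.
apply: (measurability _ (RGenOInfty.measurableE R)) => _ [_ [t ->] <-].
rewrite setTI.
have -> : (fun p : predictable_type C => val p.1.2 : R) @^-1` `]t, +oo[%classic =
    [set: Nstar C] `*` [set r : Rplus R | t < val r] `*` [set: X].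
  by apply/seteqP; split=> [[[mu r] x]|[[mu r] x] [[/= _ +] _]] /=;
    rewrite in_itv/= andbT.
exact: measurable_predictable_after _ _ _ (Nfiltration_setT t) measurableT.
Qed.

Lemma measurable_predictable_mark :
  measurable_fun [set: predictable_type C] (fun p : predictable_type C => p.2).
Proof.
move=> _ B mB; rewrite setTI.
(* The bound [-1] lies strictly below all times, so the time condition is vacuous; the bound [0]
   would lose time zero. *)
have -> : (fun p : predictable_type C => p.2) @^-1` B =
    [set: Nstar C] `*` [set r : Rplus R | -1 < val r] `*` B.
  apply/seteqP; split=> [[[mu r] x] /= Bx|[[mu r] x] [_ //]].
  by split => //; split => //=; rewrite (lt_le_trans _ (valP r))// ltrN10.
exact: measurable_predictable_after _ _ _ (Nfiltration_setT _) mB.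
Qed.

Lemma measurable_predictable_before :
  measurable_fun [set: predictable_type C]
    (fun p : predictable_type C => before mC p.1.1 p.1.2).
Proof.
apply: measurable_fun_Nstar => B mB.
apply: (measurability _ (ErealGenOInfty.measurableE R)) => _ [_ [a ->] <-].
rewrite setTI.
pose A (q : rat) : set (Nstar C) :=
  [set mu | a%:E < Nstar_ev mu (B `&` strip `[0%R, ratr q]%classic)]%E.
have -> : (fun p : predictable_type C => Nstar_ev (before mC p.1.1 p.1.2) B)
      @^-1` `]a%:E, +oo[%classic =
    \bigcup_q (A q `*` [set r : Rplus R | ratr q < val r] `*` [set: X]).
  apply/seteqP; split=> [[[mu r] x]|[[mu r] x] [q _ [[/= Amu qr] _]]] /=;
      rewrite in_itv/= andbT.
    by move=> /(before_ev_gt _ _ _ _ mB)[q qr Amu]; exists q.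
  by apply/(before_ev_gt _ _ _ _ mB); exists q.
apply: bigcupT_measurable_rat => q.
apply: measurable_predictable_after => //.
(* [A q] is the preimage of a ray under a generating map of the sigma-field at time [q]. *)
apply: sub_sigma_algebra; exists B => //.
exists `]a%:E, +oo[%classic; first exact: emeasurable_itv.
by rewrite setTI; apply/seteqP; split => mu /=; rewrite in_itv/= andbT.
Qed.

End before.

Theorem proposition3p3 (R : realType) (d : measure_display)
    (X : measurableType d) (C : nat -> set (Rplus R * X))
    (mC : forall n, measurable (C n))
    (C_disjoint : trivIset [set: nat] C)
    (C_cover : \bigcup_n C n = [set: Rplus R * X])
    (X_borel : borel_space R X)
    (h : Nstar C * Rplus R * X -> R)
    (mh : measurable_fun [set: Nstar C * Rplus R * X] h) :
  predictable_fun h <->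
  forall (mu : Nstar C) (s : Rplus R) (x : X),
    h (mu, s, x) = h (before mC mu s, s, x).
Proof.
split=> [ph mu s x|hE].
  (* The level set of [h] through [(mu, s, x)] is predictable, so it also contains the point with
     [mu] cut off before [s]. *)
  have := ph measurableT _ (measurable_set1 (h (mu, s, x))).
  rewrite setTI => mD.
  by have [_ /(_ erefl)] := predictable_before _ _ _ _ mC _ mu s x mD.
(* The identity factors [h] through a map into the product space, whose measurability is checked
   coordinate by coordinate. *)
have hbefore : (h : predictable_type C -> R) =
    h \o (fun p : predictable_type C => (before mC p.1.1 p.1.2, p.1.2, p.2)).
  by apply/funext => -[[mu s] x]; exact: hE.
rewrite /predictable_fun hbefore; apply: measurableT_comp => //.
apply: measurable_fun_pair; last exact: measurable_predictable_mark.
apply: measurable_fun_pair; last exact: measurable_predictable_time.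
exact: measurable_predictable_before.
Qed.
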